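(* There are $2^{\aleph_0}$ linear orders $L$ of order type $\omega$ on $\mathbb N$ such that $L$ is orthogonal to the natural order on $\mathbb N$.
   Context: $\mathbb N$ is the set of non-negative integers and $\omega$ is the order type of $(\mathbb N,\le)$ with the natural order. Two linear (reflexive) orders on the same set $V$ are orthogonal if the only maps $f:V\to V$ that preserve both orders (order preserving meaning $x\le y\Rightarrow f(x)\le f(y)$) are the identity map and the constant maps. *)

(* Defs.v *)
From mathcomp Require Import all_boot.
From mathcomp Require wochoice.
From mathcomp Require Import boolp classical_sets functions cardinality.

Set Implicit Arguments.
Unset Strict Implicit.
Unset Printing Implicit Defensive.

(* MathComp with the classical layer of MathComp-Analysis.  Orders are reflexive
   boolean relations [L : rel V], [L x y] meaning x <=_L y.  Equality of such
   relations is extensional (classical axioms of [boolp]), so [rel V] counts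
   each order exactly once. *)

Definition linear_order (V : Type) (L : rel V) : Prop := wochoice.total_order L.

Definition same_order_type (V W : Type) (L : rel V) (M : rel W) : Prop :=
  exists2 g : V -> W, bijective g & {mono g : x y / L x y >-> M x y}.

Definition order_type_omega (V : Type) (L : rel V) : Prop :=
  same_order_type L leq.

Definition orthogonal (V : Type) (L M : rel V) : Prop :=
  forall f : V -> V,
    {homo f : x y / L x y} -> {homo f : x y / M x y} ->
    f =1 id \/ exists c : V, f =1 (fun=> c).

(* Main.v *)
Require Import Defs.
From mathcomp Require Import all_boot.
From mathcomp Require Import boolp classical_sets functions cardinality.
From mathcomp Require Import zify.

(** An order on [nat] is a binary relation on a countable set, so there are at
    most [2 ^ aleph_0] of them.  For the converse, each 0-1 sequence [b] gives
    an order [shuffle b] of type omega, which lists the natural numbers as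

      3, 1, {0, 5}, {2, 7}, {4, 9}, {6, 11}, ...

    where the pair [{2k, 2k+5}] is written increasingly if [b k] is false and
    decreasingly if [b k] is true; hence [b] can be read off the order.  When
    [b 0] is true, so that the list starts with 3, 1, 5, 0, the order is
    orthogonal to [leq].

    Let [f] preserve both orders.  Its fibres are convex for both.  Each pair
    is placed so that it separates, in the list, consecutive integers lying
    between its two members ([shuffle_between]).  So a fibre that contains two
    consecutive integers also contains their outer neighbours, and by
    propagation it is everything ([collapse_const]).

    Otherwise [f] is strictly increasing, hence injective.  The list has one
    decreasing triple only, 3, 1, 0: the even entries increase, and so do the
    odd ones apart from 3, 1.  An injective [f] maps this triple to itself,
    hence fixes 0 ([fixes0]).  A strictly increasing self-map of an order of
    type omega fixes everything below a fixed point ([strict_homo_fix]), and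
    this applies to both orders.  No nonempty finite set is an initial segment
    of both orders, so the fixed points spread from 0 to all of [nat]
    ([strict_homo_id]). *)

(** * A family of orders of type omega *)

Local Open Scope classical_set_scope.
Local Open Scope card_scope.

(** The rank of [x] in the list 3, 1, [{0, 5}], [{2, 7}], ...: the pair
    [{2k, 2k+5}] occupies the ranks [2k+2] and [2k+3]. *)
Definition pos (b : nat -> bool) (x : nat) : nat :=
  if x == 1 then 1 else if x == 3 then 0 else
  if odd x then x - 3 + ~~ b (x - 5)./2 else x + 2 + b x./2.

Definition label (b : nat -> bool) (p : nat) : nat :=
  match p with
  | 0 => 3
  | 1 => 1
  | q.+2 => if odd q == b q./2 then q./2.*2 else q./2.*2 + 5
  end.

Definition shuffle (b : nat -> bool) : rel nat := fun x y => pos b x <= pos b y.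

(** The next two equations, with the values 1 at 1 and 0 at 3, are all that the
    proofs use about [pos]; the bits only decide the order within a pair. *)
Lemma pos_even b k : pos b k.*2 = (b k + k.*2).+2.
Proof.
by rewrite /pos odd_double doubleK !ifF; lia.
Qed.

Lemma pos_odd b k : pos b (k.*2 + 5) = (~~ b k + k.*2).+2.
Proof.
by rewrite /pos oddD odd_double addnK doubleK /= !ifF; lia.
Qed.

(** Case analysis along the list: the two initial entries, then the small and
    the large member of a pair. *)
Variant label_spec : nat -> Type :=
  | Label1 : label_spec 1
  | Label3 : label_spec 3
  | LabelEven k : label_spec k.*2
  | LabelOdd k : label_spec (k.*2 + 5).

Lemma label_cases x : label_spec x.
Proof.
rewrite -(odd_double_half x); case: (odd x); last exact: LabelEven.
case: x./2 => [|[|k]]; [exact: Label1 | exact: Label3 |].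
have -> : true + k.+2.*2 = k.*2 + 5 by lia.
exact: LabelOdd.
Qed.

Lemma label_pair b k (c : bool) :
  label b (c + k.*2).+2 = if c == b k then k.*2 else k.*2 + 5.
Proof. by rewrite /= half_bit_double oddD odd_double addbF oddb. Qed.

Lemma posK b : cancel (pos b) (label b).
Proof.
move=> x; case: (label_cases x) => [||k|k] //.
  by rewrite pos_even label_pair eqxx.
by rewrite pos_odd label_pair; case: (b k).
Qed.

Lemma labelK b : cancel (label b) (pos b).
Proof.
case=> [|[|q]] //; rewrite -(odd_double_half q) label_pair.
case: eqP => [->|/eqP]; first by rewrite pos_even.
by rewrite pos_odd; case: (odd q); case: (b _).
Qed.

Lemma pos_bij b : bijective (pos b).
Proof. exact: Bijective (posK b) (labelK b). Qed.

Lemma shuffle_linear b : linear_order (shuffle b).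
Proof.
split; last by move=> x y; exact: leq_total.
split; first by split=> [x|y x z]; [exact: leqnn | exact: leq_trans].
by move=> x y /anti_leq/(can_inj (posK b)).
Qed.

Lemma shuffle_omega b : order_type_omega (shuffle b).
Proof. by exists (pos b); [exact: pos_bij | move=> x y]. Qed.

Lemma shuffle_inj : injective shuffle.
Proof.
move=> b c bc; apply/funext => k.
have := congr1 (fun L : rel nat => L k.*2 (k.*2 + 5)) bc.
by rewrite /shuffle !pos_even !pos_odd; case: (b k); case: (c k); lia.
Qed.

(** * Maps that identify two numbers are constant *)

Lemma pos_odd_le b k : pos b k.*2.+3 <= k.*2.+1.
Proof.
case: k => [|k] //; have -> : k.+1.*2.+3 = k.*2 + 5 by lia.
by rewrite pos_odd; lia.
Qed.

(** Of two consecutive integers between [2k] and [2k+5], the odd one is at most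
    [2k+3] and has rank at most [2k+1], while the even one is at least [2k+2]
    and has rank at least [2k+4].  The ranks [2k+2] and [2k+3] in the middle are
    those of [2k] and [2k+5]. *)
Lemma shuffle_between b k i w :
  i = k.*2.+1 \/ i = k.*2.+2 -> w = k.*2 \/ w = k.*2 + 5 ->
  shuffle b i w && shuffle b w i.+1 || shuffle b i.+1 w && shuffle b w i.
Proof.
have posw : w = k.*2 \/ w = k.*2 + 5 -> k.*2.+2 <= pos b w <= k.*2.+3.
  by case=> ->; rewrite ?pos_even ?pos_odd; lia.
have pos2 := pos_even b k.+1; rewrite doubleS in pos2.
rewrite /shuffle => -[] -> /posw wk; rewrite pos2.
  suff : pos b k.*2.+1 <= k.*2.+1 by lia.
  by case: (k) => [|j] //; have := pos_odd_le b j; rewrite doubleS; lia.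
by have := pos_odd_le b k; lia.
Qed.

Lemma homo_between_eq (T : Type) (r : rel T) (f : T -> T) u v w :
  antisymmetric r -> {homo f : x y / r x y} -> f u = f v ->
  r u w && r w v || r v w && r w u -> f w = f u.
Proof.
move=> r_anti rf fuv /orP[] /andP[/rf ruw /rf rwv]; apply: r_anti.
  by rewrite ruw fuv rwv.
by rewrite rwv fuv ruw.
Qed.

Lemma shuffle_anti b : antisymmetric (shuffle b).
Proof. by have [[_ ?] _] := shuffle_linear b. Qed.

(** A collapsed pair of consecutive integers spreads in both directions: convexity
    of the fibre in the list brings in a number on each side of the pair, and
    convexity for [leq] the numbers in between.  The pair 0, 1 is below the
    reach of [shuffle_between]; it is separated by 5 because [b 0] holds, while
    otherwise 1, 0 would be adjacent in the list and could be collapsed alone. *)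
Lemma collapse_const (b : nat -> bool) (f : nat -> nat) i : b 0 ->
  {homo f : x y / shuffle b x y} -> {homo f : x y / x <= y} ->
  f i = f i.+1 -> f =1 fun=> f 0.
Proof.
move=> b0 fL fM.
have between k j w : f j = f j.+1 -> j = k.*2.+1 \/ j = k.*2.+2 ->
    w = k.*2 \/ w = k.*2 + 5 -> f w = f j.
  move=> fj jk wk.
  apply: (homo_between_eq _ _ _ _ _ _ (shuffle_anti b) fL fj).
  exact: shuffle_between jk wk.
have sandwich u v w : f u = f v -> u <= w <= v -> f w = f u.
  move=> fuv uwv; apply: (homo_between_eq _ leq) fuv _ => //; last by rewrite uwv.
  exact: anti_leq.
have down j : f j.+1 = f j.+2 -> f j = f j.+1.
  move=> fj; have f2k : f j./2.*2 = f j.+1.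
    by apply: (between j./2); lia.
  by rewrite (sandwich j./2.*2 j.+1 j) //; lia.
have up j : f j = f j.+1 -> f j.+1 = f j.+2.
  case: j => [|j] fj.
    (* The list starts with 3, 1, 5, 0. *)
    have f5 : f 5 = f 0.
      apply: (homo_between_eq _ _ _ _ _ _ (shuffle_anti b) fL fj).
      by rewrite /shuffle -[0]/0.*2 -[5]/(0.*2 + 5) pos_even pos_odd b0.
    by rewrite (sandwich 0 5 2) // (sandwich 0 5 1).
  have f5 : f (j./2.*2 + 5) = f j.+1.
    by apply: (between j./2); lia.
  by rewrite (sandwich j.+1 (j./2.*2 + 5) j.+3) -?fj //; lia.
move=> fi; have f01 : f 0 = f 1 by elim: i fi => // i IH /down.
have step j : f j = f j.+1 by elim: j => // j /up.
by elim=> [|j IH] /=; rewrite -?step.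
Qed.

(** * Strictly increasing maps are the identity *)

(** There is no room: [g] moves no number down, and it maps the numbers from [w]
    to [v] injectively and increasingly into those from [g w] to [v]. *)
Lemma strict_homo_fix (g : nat -> nat) v w :
  {homo g : x y / x < y} -> g v = v -> w <= v -> g w = w.
Proof.
move=> g_lt gv wv.
have growth d : g w + d <= g (w + d).
  elim: d => [|d IH]; first by rewrite !addn0.
  by rewrite !addnS (leq_ltn_trans IH) ?g_lt.
have expand x : x <= g x.
  by elim: x => // x IH; rewrite (leq_ltn_trans IH) ?g_lt.
by have := growth (v - w); have := expand w; rewrite subnKC // gv; lia.
Qed.

(** [strict_homo_fix] transported along the isomorphism [pos b] with [leq]. *)
Lemma shuffle_homo_fix b f v w :
  injective f -> {homo f : x y / shuffle b x y} ->
  f v = v -> shuffle b w v -> f w = w.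
Proof.
move=> f_inj fL fv wv.
pose g p := pos b (f (label b p)).
have gE x : g (pos b x) = pos b (f x) by rewrite /g posK.
apply: (can_inj (posK b)); rewrite -gE.
apply: (strict_homo_fix g (pos b v)) => //; last by rewrite gE fv.
move=> p q pq; rewrite ltn_neqAle; apply/andP; split.
  apply: contraTneq pq => /(can_inj (posK b))/f_inj/(can_inj (labelK b)) ->.
  by rewrite ltnn.
by apply: fL; rewrite /shuffle !labelK ltnW.
Qed.

Lemma same_parity_inversion b x y :
  y < x -> shuffle b x y -> odd x = odd y -> x = 3 /\ y = 1.
Proof.
have pos1 : pos b 1 = 1 by [].
have pos3 : pos b 3 = 0 by [].
rewrite /shuffle.
case: (label_cases x) => [||i|i]; case: (label_cases y) => [||j|j] //;
  by rewrite ?pos_even ?pos_odd ?pos1 ?pos3; lia.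
Qed.

(** The list has 3, 1, 0 in decreasing order, hence also [f 3], [f 1], [f 0].  Two
    of these have the same parity, so they are 3 and 1 by
    [same_parity_inversion]; the third number can then only be 0, last in the
    triple, since 3 heads the list and 2 comes after 1. *)
Lemma fixes0 b f :
  {homo f : x y / shuffle b x y} -> {homo f : x y / x < y} -> f 0 = 0.
Proof.
move=> fL f_lt.
have fyx : f 1 < f 3 by apply: f_lt.
have fzy : f 0 < f 1 by apply: f_lt.
have Lxy : shuffle b (f 3) (f 1) by apply: fL.
have Lyz : shuffle b (f 1) (f 0) by apply: fL; rewrite /shuffle (pos_even b 0).
have Lxz : shuffle b (f 3) (f 0) by apply: leq_trans Lxy Lyz.
have [xy|xz|yz] : [\/ odd (f 3) = odd (f 1), odd (f 3) = odd (f 0)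
                  | odd (f 1) = odd (f 0)].
- by case: (odd (f 3)); case: (odd (f 1)); case: (odd (f 0)); constructor.
- by have [_ y1] := same_parity_inversion b _ _ fyx Lxy xy; lia.
- have [x3 z1] := same_parity_inversion b _ _ (ltn_trans fzy fyx) Lxz xz.
  have y2 : f 1 = 2 by lia.
  by move: Lyz; rewrite y2 z1 /shuffle (pos_even b 1).
- have [y3 _] := same_parity_inversion b _ _ fzy Lyz yz.
  have /(can_inj (posK b)) x3 : pos b (f 3) = pos b 3.
    by apply/eqP; rewrite -[pos b 3]/0 -leqn0; move: Lxy; rewrite /shuffle y3.
  by move: fyx; rewrite x3 y3.
Qed.

(** The fixed points form an initial segment of both orders.  Since [2k+3] comes
    before [2k] in the list, and [2k+2 < 2k+3], they are unbounded. *)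
Lemma strict_homo_id b f :
  {homo f : x y / shuffle b x y} -> {homo f : x y / x < y} -> f =1 id.
Proof.
move=> fL f_lt.
have f_inj : injective f.
  by move=> x y; case: (ltngtP x y) => // /f_lt; lia.
have fix2 k : f k.*2 = k.*2.
  elim: k => [|k IH]; first exact: fixes0 fL f_lt.
  have fix_odd : f k.*2.+3 = k.*2.+3.
    apply: shuffle_homo_fix f_inj fL IH _; rewrite /shuffle pos_even.
    by have := pos_odd_le b k; lia.
  by apply: strict_homo_fix f_lt fix_odd _; rewrite doubleS.
by move=> x; apply: strict_homo_fix f_lt (fix2 x) _; lia.
Qed.

Lemma shuffle_orthogonal (b : nat -> bool) : b 0 -> orthogonal (shuffle b) leq.
Proof.
move=> b0 f fL fM.
have [f_lt|/existsNP[i /negP]] := pselect (forall i, f i < f i.+1).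
  by left; apply: strict_homo_id fL (homo_ltn ltn_trans f_lt).
rewrite -leqNgt => fi; right; exists (f 0).
apply: (collapse_const b f i) => //.
by apply: anti_leq; rewrite fi andbT; apply: fM.
Qed.

(** * Counting *)

Definition cons_true (c : nat -> bool) : nat -> bool :=
  fun n => if n is k.+1 then c k else true.

Lemma cons_true_inj : injective cons_true.
Proof.
by move=> c d cd; apply/funext => k; have := congr1 (fun g => g k.+1) cd.
Qed.

Lemma card_le_inj (T U : Type) (A : set T) (B : set U) (f : T -> U) :
  {in A &, injective f} -> f @` A `<=` B -> A #<= B.
Proof.
move=> /inj_card_eq fA /subset_card_le; apply: card_le_trans.
by move: fA; rewrite card_eq_sym card_eq_le => /andP[].
Qed.

Theorem theorem2 :
  [set L : rel nat |
    [/\ linear_order L, order_type_omega L & orthogonal L leq]]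
  #= [set: nat -> bool].
Proof.
rewrite card_eq_le; apply/andP; split.
  pose code (L : rel nat) n :=
    if unpickle n is Some xy then L xy.1 xy.2 else false.
  apply: (card_le_inj _ _ _ _ code) => // L M _ _ LM.
  apply/funext => x; apply/funext => y.
  by have := congr1 (fun g => g (pickle (x, y))) LM; rewrite /code !pickleK.
apply: (card_le_inj _ _ _ _ (fun c => shuffle (cons_true c))).
  by move=> c d _ _ /shuffle_inj/cons_true_inj.
move=> _ [c _ <-]; split; first exact: shuffle_linear.
  exact: shuffle_omega.
exact: shuffle_orthogonal.
Qed.
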